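(* Let $0<\mu<1$ and let $\ell_1,\ell_2\subset\mathbb{R}^2$ be two directed lines. Then the set of all $\mu$-Bounded-Distortion planar affine transformations $f:\mathbb{R}^2\to\mathbb{R}^2$ that map the directed line $\ell_1$ to the directed line $\ell_2$ (preserving direction) is a convex subset of the (6-dimensional) real vector space of affine maps $\mathbb{R}^2\to\mathbb{R}^2$.
   Context: Every planar affine map $f:\mathbb{R}^2\to\mathbb{R}^2$ can be written uniquely as $f(\mathbf{x})=B\mathbf{x}+C\mathbf{x}+\mathbf{t}$ with $$B=\begin{pmatrix}a&b\\-b&a\end{pmatrix},\qquad C=\begin{pmatrix}c&d\\d&-c\end{pmatrix},\qquad \mathbf{t}\in\mathbb{R}^2,$$ where $a,b,c,d\in\mathbb{R}$ ($B$ is the similarity part, $C$ the anti-similarity part). For $B\neq 0$ define $$\mu_f=\frac{\|C\|}{\|B\|}=\sqrt{\frac{c^2+d^2}{a^2+b^2}},$$ with $\|\cdot\|$ the Frobenius norm. For a parameter $0<\mu<1$, the affine map $f$ is called $\mu$-Bounded-Distortion if $\mu_f\le\mu$. A directed line is a line $\ell=\{\mathbf{p}+s\mathbf{u}: s\in\mathbb{R}\}$ in $\mathbb{R}^2$ together with a choice of direction, given by a direction vector $\mathbf{u}\ne 0$ up to positive scaling. An affine map $f$ maps a directed line $\ell_1$ (with direction $\mathbf{u}_1$) to a directed line $\ell_2$ (with direction $\mathbf{u}_2$) if $f(\ell_1)=\ell_2$ and direction is preserved, i.e. the linear part of $f$ sends $\mathbf{u}_1$ to a strictly positive multiple of $\mathbf{u}_2$.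 The vector space structure on affine maps is pointwise addition and scalar multiplication (equivalently, the coordinates $(a,b,c,d,\mathbf{t})$). *)

(* Defs.v *)
From HB Require Import structures.
From mathcomp Require Import all_boot all_order all_algebra.
From mathcomp Require Import ring.
From mathcomp Require Export boolp classical_sets functions reals convex.

Set Implicit Arguments.
Unset Strict Implicit.
Unset Printing Implicit Defensive.

Import Order.TTheory GRing.Theory Num.Theory.

Local Open Scope classical_set_scope.
Local Open Scope ring_scope.

Section AffineMaps.
Context {R : realType}.

Definition is_affine (f : 'cV[R]_2 -> 'cV[R]_2) : Prop :=
  exists (A : 'M[R]_2) (t : 'cV[R]_2), forall x, f x = A *m x + t.

Definition affine_pred : {pred 'cV[R]_2 -> 'cV[R]_2} :=
  fun f => `[< is_affine f >].

Lemma affine_submod_closed : submod_closed affine_pred.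
Proof.
split.
  by apply/asboolP; exists 0, 0 => x; rewrite mul0mx addr0.
move=> k f g /asboolP[A [t fE]] /asboolP[B [s gE]].
apply/asboolP; exists (k *: A + B), (k *: t + s) => x.
rewrite (_ : (k *: f + g) x = k *: f x + g x)//.
by rewrite fE gE mulmxDl -scalemxAl scalerDr addrACA.
Qed.

HB.instance Definition _ :=
  GRing.isSubmodClosed.Build R ('cV[R]_2 -> 'cV[R]_2) affine_pred
    affine_submod_closed.

End AffineMaps.

(* The space of affine maps: a linear subspace of the space of all functions
   R^2 -> R^2, hence with the pointwise operations. *)
Record affmap (R : realType) := AffMap {
  affmap_fun :> 'cV[R]_2 -> 'cV[R]_2;
  affmap_affine : affmap_fun \in affine_pred }.

HB.instance Definition _ (R : realType) := [isSub for @affmap_fun R].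
HB.instance Definition _ (R : realType) := [Choice of affmap R by <:].
HB.instance Definition _ (R : realType) :=
  [SubChoice_isSubLmodule of affmap R by <:].

Section Distortion.
Context {R : realType}.
Implicit Types (f g : affmap R) (A : 'M[R]_2).

Lemma affmapP f : is_affine f.
Proof. exact/asboolP/affmap_affine. Qed.

Lemma affmapD f g x : (f + g) x = f x + g x.
Proof. by []. Qed.

Lemma affmapZ k f x : (k *: f) x = k *: f x.
Proof. by []. Qed.

Definition linear_part f : 'M[R]_2 :=
  \matrix_(i, j) (f (delta_mx j 0) - f 0) i 0.

Definition translation_part f : 'cV[R]_2 := f 0.

Lemma linear_part_eq f A t :
  (forall x, f x = A *m x + t) -> linear_part f = A.
Proof.
move=> fE; apply/matrixP => i j.
by rewrite mxE !fE mulmx0 add0r addrK -colE mxE.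
Qed.

Lemma affmapE f x : f x = linear_part f *m x + translation_part f.
Proof.
have [A [t fE]] := affmapP f.
by rewrite (linear_part_eq fE) /translation_part !fE mulmx0 add0r.
Qed.

Definition sim_mx (a b : R) : 'M[R]_2 :=
  \matrix_(i, j) if i == j then a else if i == 0 then b else - b.

Definition antisim_mx (c d : R) : 'M[R]_2 :=
  \matrix_(i, j) if i == j then (if i == 0 then c else - c) else d.

(* Coefficients a, b (resp. c, d) obtained by solving
   linear_part f = sim_mx a b + antisim_mx c d; the decomposition and its
   uniqueness are [affmap_decomp] and [affmap_decomp_uniq]. *)
Definition similarity_part f : 'M[R]_2 :=
  let A := linear_part f in
  sim_mx ((A 0 0 + A 1 1) / 2) ((A 0 1 - A 1 0) / 2).

Definition antisimilarity_part f : 'M[R]_2 :=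
  let A := linear_part f in
  antisim_mx ((A 0 0 - A 1 1) / 2) ((A 0 1 + A 1 0) / 2).

Lemma linear_part_split f :
  linear_part f = similarity_part f + antisimilarity_part f.
Proof.
apply/matrixP => i j; rewrite /similarity_part /antisimilarity_part.
move: (linear_part f) => A; rewrite !mxE.
have E0 (k : 'I_2) : k = 0 \/ k = 1.
  by case: k => [[|[|//]]] ?; [left|right]; apply/val_inj.
by case: (E0 i) => ->; case: (E0 j) => -> /=; field.
Qed.

Lemma affmap_decomp f x :
  f x = similarity_part f *m x + antisimilarity_part f *m x
        + translation_part f.
Proof. by rewrite affmapE linear_part_split mulmxDl. Qed.

Lemma affmap_decomp_uniq f a b c d t :
  (forall x, f x = sim_mx a b *m x + antisim_mx c d *m x + t) ->
  [/\ similarity_part f = sim_mx a b,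
      antisimilarity_part f = antisim_mx c d & translation_part f = t].
Proof.
move=> fE.
have fE' x : f x = (sim_mx a b + antisim_mx c d) *m x + t.
  by rewrite fE mulmxDl.
split; last by rewrite /translation_part fE !mulmx0 !add0r.
- rewrite /similarity_part (linear_part_eq fE') !mxE /=.
  by congr sim_mx; field.
- rewrite /antisimilarity_part (linear_part_eq fE') !mxE /=.
  by congr antisim_mx; field.
Qed.

Definition frobenius_norm A : R := Num.sqrt (\sum_i \sum_j A i j ^+ 2).

(* Only meaningful when [similarity_part f != 0]. *)
Definition distortion f : R :=
  frobenius_norm (antisimilarity_part f) / frobenius_norm (similarity_part f).

Definition bounded_distortion (mu : R) f : Prop :=
  similarity_part f != 0 /\ distortion f <= mu.

Lemma frobenius_sim a b :
  frobenius_norm (sim_mx a b) = Num.sqrt (2 * (a ^+ 2 + b ^+ 2)).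
Proof.
rewrite /frobenius_norm !big_ord_recl !big_ord0 !mxE /=.
by congr Num.sqrt; ring.
Qed.

Lemma frobenius_antisim c d :
  frobenius_norm (antisim_mx c d) = Num.sqrt (2 * (c ^+ 2 + d ^+ 2)).
Proof.
rewrite /frobenius_norm !big_ord_recl !big_ord0 !mxE /=.
by congr Num.sqrt; ring.
Qed.

Lemma distortionE f a b c d :
  similarity_part f = sim_mx a b -> antisimilarity_part f = antisim_mx c d ->
  distortion f = Num.sqrt ((c ^+ 2 + d ^+ 2) / (a ^+ 2 + b ^+ 2)).
Proof.
move=> Bf Cf; rewrite /distortion Bf Cf frobenius_sim frobenius_antisim.
have s2 : Num.sqrt 2 != 0 :> R by rewrite sqrtr_eq0 -ltNge ltr0n.
rewrite !sqrtrM ?ler0n// ?addr_ge0 ?sqr_ge0// sqrtrV ?addr_ge0 ?sqr_ge0//.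
by rewrite invfM mulrACA divff// mul1r.
Qed.

Definition affmap_coord f : 'rV[R]_6 :=
  (row_mx (mxvec (linear_part f)) (translation_part f)^T : 'rV[R]_(2 * 2 + 2)).

Lemma affmap_vect_axiom : Vector.axiom 6 (affmap R).
Proof.
exists affmap_coord.
- move=> k f g; apply/matrixP => i j; rewrite /affmap_coord.
  have -> : linear_part (k *: f + g) = k *: linear_part f + linear_part g.
    apply: (@linear_part_eq _ _ (k *: translation_part f + translation_part g)).
    move=> x; rewrite affmapD affmapZ !affmapE mulmxDl -scalemxAl scalerDr.
    by rewrite addrACA.
  have -> : translation_part (k *: f + g)
            = k *: translation_part f + translation_part g by [].
  by rewrite !linearP -add_row_mx -scale_row_mx.
- have affM A t : (fun x => A *m x + t) \in @affine_pred R.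
    by apply/asboolP; exists A, t.
  exists (fun v : 'rV[R]_(2 * 2 + 2) =>
            AffMap (affM (vec_mx (lsubmx v)) (rsubmx v)^T)).
  + move=> f; apply/val_inj/funext => x.
    by rewrite /= row_mxKl row_mxKr mxvecK trmxK [RHS]affmapE.
  + move=> v /=; rewrite /affmap_coord.
    rewrite (@linear_part_eq _ (vec_mx (lsubmx (v : 'rV_(2 * 2 + 2))))
              (rsubmx (v : 'rV_(2 * 2 + 2)))^T)//.
    by rewrite /translation_part /= mulmx0 add0r trmxK vec_mxK hsubmxK.
Qed.

HB.instance Definition _ :=
  Lmodule_hasFinDim.Build R (affmap R) affmap_vect_axiom.

Lemma dim_affmap : \dim {: affmap R} = 6.
Proof. exact: dimvf. Qed.

End Distortion.

(* A directed line is given by a base point and a direction vector; different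
   representatives of the same directed line are interchangeable below, by
   [maps_directed_line_eq]. *)
Record directed_line (R : realType) := DirectedLine {
  line_point : 'cV[R]_2;
  line_dir : 'cV[R]_2;
  line_dir_neq0 : line_dir != 0 }.

Section DirectedLines.
Context {R : realType}.
Implicit Types (f : affmap R) (l : directed_line R).

Definition line_carrier l : set 'cV[R]_2 :=
  [set line_point l + s *: line_dir l | s in setT].

Definition maps_directed_line f l1 l2 : Prop :=
  f @` line_carrier l1 = line_carrier l2 /\
  exists2 k : R, 0 < k & linear_part f *m line_dir l1 = k *: line_dir l2.

Definition same_directed_line l l' : Prop :=
  line_carrier l = line_carrier l' /\
  exists2 k : R, 0 < k & line_dir l = k *: line_dir l'.

Lemma maps_directed_line_eq f l1 l1' l2 l2' :
  same_directed_line l1 l1' -> same_directed_line l2 l2' ->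
  maps_directed_line f l1 l2 <-> maps_directed_line f l1' l2'.
Proof.
move=> [c1 [k1 k1_gt0 d1]] [c2 [k2 k2_gt0 d2]].
rewrite /maps_directed_line c1 c2 d1 d2 -scalemxAr.
split=> -[im [k k_gt0 E]]; split=> //.
  exists (k1^-1 * (k * k2)); first by rewrite !mulr_gt0 ?invr_gt0.
  apply: (@scalerI _ _ k1); first by rewrite gt_eqF.
  by rewrite E !scalerA mulrA divff ?gt_eqF// mul1r.
exists (k1 * k / k2); first by rewrite divr_gt0 ?mulr_gt0.
by rewrite E !scalerA divfK// gt_eqF.
Qed.

End DirectedLines.

(* Main.v *)
(** The affine map with linear part [A = B + C] has distortion at most [mu] iff the
    quadratic form [mu ^+ 2 * `|B|^2 - `|C|^2] is nonnegative at [A].  The form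
    is indefinite, so this alone is not a convex condition; but if [A] sends [u]
    to a positive multiple of [v], then the component of [C u] normal to [v]
    cancels that of [B u].  In the coordinates [x = <B u, v>],
    [y = det (B u, v)], [r = <C u, v>], where moreover [0 < x + r], the condition
    becomes [r ^+ 2 + (1 - mu ^+ 2) * y ^+ 2 <= mu ^+ 2 * x ^+ 2] with [0 < x],
    i.e. one nappe of a second-order cone. *)
Require Import Defs.
From mathcomp Require Import all_boot all_order all_algebra.
From mathcomp Require Import ring lra interval_inference.

Import Order.TTheory GRing.Theory Num.Theory.

Local Open Scope classical_set_scope.
Local Open Scope ring_scope.

(** Cauchy-Schwarz for the weighted form, by Lagrange's identity: the product of the two left-hand
    sides exceeds the square of [r1 * r2 + q * (y1 * y2)] by [q * (r1 * y2 - r2 * y1) ^+ 2]. *)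
Lemma cauchy_schwarz_cone (R : realDomainType) (q p1 p2 r1 r2 y1 y2 : R) :
  0 <= q -> 0 <= p1 -> 0 <= p2 ->
  r1 ^+ 2 + q * y1 ^+ 2 <= p1 ^+ 2 -> r2 ^+ 2 + q * y2 ^+ 2 <= p2 ^+ 2 ->
  r1 * r2 + q * (y1 * y2) <= p1 * p2.
Proof.
move=> q0 p10 p20 h1 h2; apply: ler_normlW.
rewrite -[leRHS]ger0_norm ?mulr_ge0// -ler_sqr ?nnegrE// !real_normK ?num_real//.
rewrite exprMn.
have le_prod : (r1 ^+ 2 + q * y1 ^+ 2) * (r2 ^+ 2 + q * y2 ^+ 2) <= p1 ^+ 2 * p2 ^+ 2.
  by apply: ler_pM => //; apply: addr_ge0; rewrite ?sqr_ge0 ?(mulr_ge0 q0) ?sqr_ge0.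
apply: le_trans le_prod; rewrite -subr_ge0.
rewrite [leRHS](_ : _ = q * (r1 * y2 - r2 * y1) ^+ 2); last by ring.
by rewrite mulr_ge0 ?sqr_ge0.
Qed.

(** Selects the nappe: if [x <= 0], then [r > - x >= 0], so [r ^+ 2] exceeds [x ^+ 2], hence also
    [(mu * x) ^+ 2]. *)
Lemma cone_half_gt0 (R : realDomainType) (mu x y r : R) :
  0 <= mu -> mu <= 1 -> 0 < x + r ->
  r ^+ 2 + (1 - mu ^+ 2) * y ^+ 2 <= (mu * x) ^+ 2 -> 0 < x.
Proof.
move=> mu0 mu1 xr h; rewrite ltNge; apply/negP => x0.
have mu2 : 0 <= 1 - mu ^+ 2 by rewrite subr_ge0 expr_le1.
have rx : (mu * x) ^+ 2 <= x ^+ 2 by rewrite exprMn ler_piMl ?sqr_ge0// -subr_ge0.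
have := mulr_ge0 mu2 (sqr_ge0 y).
have : 0 < (x + r) * (r - x) by apply: mulr_gt0 => //; lra.
have -> : (x + r) * (r - x) = r ^+ 2 - x ^+ 2 by ring.
lra.
Qed.

Lemma mulmx2E (R : pzSemiRingType) (A : 'M[R]_2) (u : 'cV[R]_2) i :
  (A *m u) i 0 = A i 0 * u 0 0 + A i 1 * u 1 0.
Proof.
rewrite mxE !big_ord_recl big_ord0 addr0.
by have -> : lift ord0 ord0 = 1 :> 'I_2 by apply/val_inj.
Qed.

Lemma cV2_sqr_gt0 (R : realDomainType) (u : 'cV[R]_2) :
  u != 0 -> 0 < u 0 0 ^+ 2 + u 1 0 ^+ 2.
Proof.
move=> u0; rewrite lt_neqAle eq_sym addr_ge0 ?sqr_ge0// andbT.
apply: contra u0; rewrite paddr_eq0 ?sqr_ge0// !sqrf_eq0 => /andP[/eqP u00 /eqP u10].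
apply/eqP/matrixP => i j; rewrite mxE ord1.
by case: i => [[|[|//]]] ?; [rewrite -[RHS]u00|rewrite -[RHS]u10];
  congr (u _ _); apply/val_inj.
Qed.

(* Four times the polar form of [mu ^+ 2 * (a ^+ 2 + b ^+ 2) - (c ^+ 2 + d ^+ 2)],
   where [a, b, c, d] are the coefficients of the (anti-)similarity parts. *)
Definition distortion_form {R : pzRingType} (mu : R) (A B : 'M[R]_2) : R :=
  mu ^+ 2 * ((A 0 0 + A 1 1) * (B 0 0 + B 1 1)
             + (A 0 1 - A 1 0) * (B 0 1 - B 1 0))
  - ((A 0 0 - A 1 1) * (B 0 0 - B 1 1) + (A 0 1 + A 1 0) * (B 0 1 + B 1 0)).

Lemma distortion_form_comb (R : comPzRingType) (mu s t : R) (A B : 'M[R]_2) :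
  let M := s *: A + t *: B in
  distortion_form mu M M =
  s ^+ 2 * distortion_form mu A A + 2 * (s * t) * distortion_form mu A B
  + t ^+ 2 * distortion_form mu B B.
Proof. by rewrite /distortion_form !mxE; ring. Qed.

(** Controls the cross term of [distortion_form_comb]: [A] and [B] lie on the same nappe, where the
    polar form is nonnegative by Cauchy-Schwarz. *)
Lemma distortion_form_ge0 (R : realFieldType) (mu k l : R) (u v : 'cV[R]_2)
    (A B : 'M[R]_2) :
  0 <= mu -> mu <= 1 -> u != 0 -> v != 0 -> 0 < k -> 0 < l ->
  A *m u = k *: v -> B *m u = l *: v ->
  0 <= distortion_form mu A A -> 0 <= distortion_form mu B B ->
  0 <= distortion_form mu A B.
Proof.
move=> mu0 mu1 /cV2_sqr_gt0 u0 /cV2_sqr_gt0 v0 k0 l0 Au Bu.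
pose N := (u 0 0 ^+ 2 + u 1 0 ^+ 2) * (v 0 0 ^+ 2 + v 1 0 ^+ 2).
have N0 : 0 < N by rewrite mulr_gt0.
(* [X], [Y] and [C] are twice the coordinates [x], [y] and [r], which avoids halves. *)
pose X (M : 'M[R]_2) := (M 0 0 + M 1 1) * (u 0 0 * v 0 0 + u 1 0 * v 1 0)
  + (M 0 1 - M 1 0) * (u 1 0 * v 0 0 - u 0 0 * v 1 0).
pose Y (M : 'M[R]_2) := (M 0 0 + M 1 1) * (u 0 0 * v 1 0 - u 1 0 * v 0 0)
  + (M 0 1 - M 1 0) * (u 1 0 * v 1 0 + u 0 0 * v 0 0).
pose C (M : 'M[R]_2) := (M 0 0 - M 1 1) * (u 0 0 * v 0 0 - u 1 0 * v 1 0)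
  + (M 0 1 + M 1 0) * (u 1 0 * v 0 0 + u 0 0 * v 1 0).
(* The left-hand side is twice the determinant of the anti-similarity image of [u] with [v]; added
   to [Y M] it gives twice that of [M *m u] with [v], which vanishes. *)
have normal_cancel j M : M *m u = j *: v ->
    (M 0 0 - M 1 1) * (u 0 0 * v 1 0 + u 1 0 * v 0 0)
    + (M 0 1 + M 1 0) * (u 1 0 * v 1 0 - u 0 0 * v 0 0) = - Y M.
  move=> /matrixP E; have := E 0 0; have := E 1 0.
  rewrite !mulmx2E !mxE /Y => E1 E0.
  have Z : 2 * ((M 0 0 * u 0 0 + M 0 1 * u 1 0) * v 1 0
    - (M 1 0 * u 0 0 + M 1 1 * u 1 0) * v 0 0) = 0 by rewrite E0 E1; ring.
  by apply/eqP; rewrite -subr_eq0 -Z; apply/eqP; ring.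
have formE j j' M M' : M *m u = j *: v -> M' *m u = j' *: v ->
    N * distortion_form mu M M' =
    (mu * X M) * (mu * X M') - (C M * C M' + (1 - mu ^+ 2) * (Y M * Y M')).
  move=> /normal_cancel E /normal_cancel E'.
  have YY : Y M * Y M' = - Y M * - Y M' by rewrite mulrNN.
  have -> : (mu * X M) * (mu * X M') - (C M * C M' + (1 - mu ^+ 2) * (Y M * Y M'))
    = mu ^+ 2 * (X M * X M' + Y M * Y M') - (C M * C M' + Y M * Y M') by ring.
  (* Only the subtracted [Y M * Y M'] becomes the product of anti-similarity normal components; the
     rest is Lagrange's identity for each part. *)
  by rewrite [in X in _ - X]YY -E -E' /N /distortion_form /X /Y /C; ring.
have cone j M : 0 < j -> M *m u = j *: v -> 0 <= distortion_form mu M M ->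
    0 <= mu * X M /\ C M ^+ 2 + (1 - mu ^+ 2) * Y M ^+ 2 <= (mu * X M) ^+ 2.
  move=> j0 E; rewrite -(pmulr_rge0 _ N0) (formE _ _ _ _ E E) -!expr2 subr_ge0.
  move=> h; split=> //; rewrite mulr_ge0// ltW//.
  apply: cone_half_gt0 h => //.
  (* Both sides are twice the inner product of [M *m u] with [v]. *)
  have -> : X M + C M = 2 * j * (v 0 0 ^+ 2 + v 1 0 ^+ 2).
    move/matrixP : E => E; have := E 0 0; have := E 1 0.
    rewrite !mulmx2E !mxE /X /C => E1 E0.
    transitivity (2 * ((M 0 0 * u 0 0 + M 0 1 * u 1 0) * v 0 0
      + (M 1 0 * u 0 0 + M 1 1 * u 1 0) * v 1 0)); first by ring.
    by rewrite E0 E1; ring.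
  by rewrite !mulr_gt0.
move=> /(cone _ _ k0 Au)[XA hA] /(cone _ _ l0 Bu)[XB hB].
rewrite -(pmulr_rge0 _ N0) (formE _ _ _ _ Au Bu) subr_ge0.
by apply: cauchy_schwarz_cone; rewrite ?subr_ge0 ?expr_le1.
Qed.

Section BoundedDistortion.
Context {R : realType}.
Implicit Types (f g : affmap R) (l : directed_line R).

Lemma sim_mx_eq0 (a b : R) : (sim_mx a b == 0) = (a ^+ 2 + b ^+ 2 == 0).
Proof.
rewrite paddr_eq0 ?sqr_ge0// !sqrf_eq0; apply/eqP/andP => [/matrixP E|].
  by have := E 0 0; have := E 0 1; rewrite !mxE /= => -> ->.
move=> [/eqP-> /eqP->]; apply/matrixP => i j.
by rewrite !mxE oppr0 !if_same.
Qed.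

(** Clearing the denominator loses the condition that the similarity part is nonzero. It is
    recovered from [u]: if that part vanished, the form would force the anti-similarity part to
    vanish too, so [u] would go to [0], not to [k *: v]. *)
Lemma bounded_distortionE (mu : R) f (u v : 'cV[R]_2) (k : R) :
  0 <= mu -> v != 0 -> 0 < k -> linear_part f *m u = k *: v ->
  bounded_distortion mu f <->
  0 <= distortion_form mu (linear_part f) (linear_part f).
Proof.
move=> mu0 v0 k0 fu.
pose a := (linear_part f 0 0 + linear_part f 1 1) / 2.
pose b := (linear_part f 0 1 - linear_part f 1 0) / 2.
pose c := (linear_part f 0 0 - linear_part f 1 1) / 2.
pose d := (linear_part f 0 1 + linear_part f 1 0) / 2.
have formE : distortion_form mu (linear_part f) (linear_part f)
    = 4 * (mu ^+ 2 * (a ^+ 2 + b ^+ 2) - (c ^+ 2 + d ^+ 2)).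
  by rewrite /distortion_form /a /b /c /d; field.
have distE : a ^+ 2 + b ^+ 2 != 0 -> (distortion f <= mu) =
    (c ^+ 2 + d ^+ 2 <= mu ^+ 2 * (a ^+ 2 + b ^+ 2)).
  move=> ab0; have ab : 0 < a ^+ 2 + b ^+ 2.
    by rewrite lt_neqAle eq_sym ab0 addr_ge0 ?sqr_ge0.
  have muE : mu = Num.sqrt (mu ^+ 2) by rewrite sqrtr_sqr ger0_norm.
  by rewrite (@distortionE _ f a b c d)// {1}muE ler_sqrt ?sqr_ge0// ler_pdivrMr.
have simE : (similarity_part f == 0) = (a ^+ 2 + b ^+ 2 == 0).
  exact: sim_mx_eq0.
rewrite formE pmulr_rge0// subr_ge0 /bounded_distortion simE.
split=> [[ab0]|h]; first by rewrite distE.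
suff ab0 : a ^+ 2 + b ^+ 2 != 0 by rewrite distE.
apply/negP => /eqP ab0.
move: h; rewrite ab0 mulr0 => cd0.
have cd : c ^+ 2 + d ^+ 2 = 0 by apply/le_anti; rewrite cd0 addr_ge0 ?sqr_ge0.
have cE0 : c = 0.
  by apply/eqP; move/eqP: cd; rewrite paddr_eq0 ?sqr_ge0// !sqrf_eq0 => /andP[].
have dE0 : d = 0.
  by apply/eqP; move/eqP: cd; rewrite paddr_eq0 ?sqr_ge0// !sqrf_eq0 => /andP[].
have sim0 : similarity_part f = 0 by apply/eqP; rewrite simE ab0.
have antisim0 : antisimilarity_part f = 0.
  rewrite /antisimilarity_part -/c -/d cE0 dE0; apply/matrixP => i j.
  by rewrite !mxE oppr0 !if_same.
move/eqP: fu; rewrite linear_part_split sim0 antisim0 addr0 mul0mx eq_sym.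
by rewrite scaler_eq0 gt_eqF// (negbTE v0).
Qed.

(** Once directions agree, the image is a line parallel to [l2], so a single common point decides
    equality. *)
Lemma maps_directed_lineP f l1 l2 :
  maps_directed_line f l1 l2 <->
  line_carrier l2 (f (line_point l1)) /\
  exists2 k : R, 0 < k & linear_part f *m line_dir l1 = k *: line_dir l2.
Proof.
split=> -[im [k k0 E]]; (split; last by exists k).
  by rewrite -im; exists (line_point l1) => //; exists 0 => //; rewrite scale0r addr0.
have fE s : f (line_point l1 + s *: line_dir l1)
    = f (line_point l1) + (s * k) *: line_dir l2.
  by rewrite !affmapE mulmxDr -scalemxAr E scalerA addrAC.
case: im => s0 _ ps0.
apply/seteqP; split => [_ [_ [s _ <-] <-]|_ [s _ <-]].
  by exists (s0 + s * k) => //; rewrite fE -ps0 scalerDl addrA.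
(* On parameters [f] acts as [r] to [s0 + r * k], which is inverted here. *)
exists (line_point l1 + ((s - s0) / k) *: line_dir l1); first by exists ((s - s0) / k).
by rewrite fE divfK ?gt_eqF// -ps0 -addrA -scalerDl (addrC s0) subrK.
Qed.

Lemma affmap_combE (s t : R) f g x : (s *: f + t *: g) x = s *: f x + t *: g x.
Proof. by []. Qed.

Lemma linear_part_comb (s t : R) f g :
  linear_part (s *: f + t *: g) = s *: linear_part f + t *: linear_part g.
Proof.
by apply/matrixP => i j; rewrite mxE !affmap_combE !mxE; ring.
Qed.

End BoundedDistortion.

Theorem proposition1 (R : realType) (mu : R) (l1 l2 : directed_line R) :
  0 < mu -> mu < 1 ->
  convex_set [set f : affmap R |
    bounded_distortion mu f /\ maps_directed_line f l1 l2].
Proof.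
move=> mu0 mu1; apply/convex_setW => f g /set_mem[bf mf] /set_mem[bg mg] t t0 t1.
apply/mem_set => /=.
set s := t%:num in t0 t1.
have s1 : 0 < 1 - s by rewrite subr_gt0.
have -> : conv t f g = s *: f + (1 - s) *: g by [].
have [fp [k k0 fu]] := (maps_directed_lineP _ _ _).1 mf.
have [gp [l l0 gu]] := (maps_directed_lineP _ _ _).1 mg.
have u0 := line_dir_neq0 l1; have v0 := line_dir_neq0 l2.
have hk : 0 < s * k + (1 - s) * l by rewrite addr_gt0 ?mulr_gt0.
have hu : linear_part (s *: f + (1 - s) *: g) *m line_dir l1
    = (s * k + (1 - s) * l) *: line_dir l2.
  by rewrite linear_part_comb mulmxDl -!scalemxAl fu gu !scalerA -scalerDl.
split.
  apply/(bounded_distortionE _ _ _ _ _ (ltW mu0) v0 hk hu).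
  have Qf := (bounded_distortionE _ _ _ _ _ (ltW mu0) v0 k0 fu).1 bf.
  have Qg := (bounded_distortionE _ _ _ _ _ (ltW mu0) v0 l0 gu).1 bg.
  have Qfg : 0 <= distortion_form mu (linear_part f) (linear_part g).
    exact: (distortion_form_ge0 _ _ _ _ _ _ _ _ (ltW mu0) (ltW mu1) u0 v0 k0 l0).
  (* The form splits into two diagonal terms and a cross term, nonnegative by [Qf], [Qg] and
     [Qfg]. *)
  rewrite linear_part_comb distortion_form_comb.
  by rewrite !addr_ge0// !mulr_ge0// ?sqr_ge0// ltW.
apply/maps_directed_lineP; split; last by exists (s * k + (1 - s) * l).
rewrite affmap_combE; move: fp gp => [x _ <-] [y _ <-].
exists (s * x + (1 - s) * y) => //.
by rewrite !scalerDr !scalerA addrACA -!scalerDl addrCA subrr addr0 scale1r.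
Qed.
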